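(* Let $X,Y,Z,W$ be compact metric spaces with uniformly contractive iterated function systems $\{\tau_x:Z\to Z\}_{x\in X}$ and $\{\tau_y:W\to W\}_{y\in Y}$, let $\mu\in\mathcal{P}(X)$, $\nu\in\mathcal{P}(Y)$, and let $c:X\times Y\times Z\times W\to\mathbb{R}$ be continuous. Let $\Phi_c$ be the set of pairs of continuous functions $\varphi\in C(X)$, $\psi\in C(Y)$ for which there exist $f\in C(W)$ and $g\in C(Z)$ such that $$c(x,y,z,w)+g(\tau_x(z))-g(z)+f(\tau_y(w))-f(w)\le\varphi(x)+\psi(y)\quad\text{for all }(x,y,z,w)\in X\times Y\times Z\times W.$$ Then $$\inf_{(\varphi,\psi)\in\Phi_c}\int\varphi\,d\mu+\int\psi\,d\nu=\sup_{\pi\in\Pi(\mu,\nu,\tau)}\int c\,d\pi.$$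
   Context: $\mathcal{P}(S)$ is the set of Borel probability measures on a compact metric space $S$, and $C(S)$ the space of continuous real functions on $S$. Uniformly contractive means: there is a constant $0<\gamma<1$ with $d(\tau_{x_1}(z_1),\tau_{x_2}(z_2))\le\gamma[d(x_1,x_2)+d(z_1,z_2)]$ for all $x_i\in X$, $z_i\in Z$; likewise for $\{\tau_y\}$ on $Y,W$. $\Pi(\mu,\nu,\tau)$ is the set of $\pi\in\mathcal{P}(X\times Y\times Z\times W)$ with $X$-marginal $\mu$ and $Y$-marginal $\nu$ satisfying $\int g(\tau_x(z))\,d\pi=\int g(z)\,d\pi$ for all $g\in C(Z)$ and $\int f(\tau_y(w))\,d\pi=\int f(w)\,d\pi$ for all $f\in C(W)$. *)

(* Defs.v *)
From HB Require Import structures.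
From mathcomp Require Import all_boot all_order all_algebra.
From mathcomp Require Import all_classical all_reals all_analysis.

Set Implicit Arguments.
Unset Strict Implicit.
Unset Printing Implicit Defensive.

Import Order.TTheory GRing.Theory Num.Theory.
Import numFieldTopology.Exports.

Local Open Scope classical_set_scope.
Local Open Scope ring_scope.

(* Measurable types are pointed, so that carrying a Borel measure requires a
   metric space with a chosen point, i.e. a nonempty metric space. *)
#[short(type="pmetricType")]
HB.structure Definition PMetric (R : numDomainType) :=
  { T of Metric R T & isPointed T }.

HB.instance Definition _ (S T : ptopologicalType) := Pointed.on (S * T)%type.

Notation borel T := (g_sigma_algebraType (@open T)).

(* For T a product, this is the Borel sigma-algebra of the product topology. *)
Notation borel_probability T R := (probability (borel T) R).

Definition uniformly_contractive (R : realType) (X Z : pmetricType R)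
    (tau : X -> Z -> Z) : Prop :=
  exists gamma : R, [/\ 0 < gamma, gamma < 1 &
    forall (x1 x2 : X) (z1 z2 : Z),
      mdist (tau x1 z1) (tau x2 z2) <= gamma * (mdist x1 x2 + mdist z1 z2)].

(* A library measure is a total function on sets, meaningful on measurable ones
   only: measures are compared on Borel sets. *)
Definition has_marginal (R : realType) (S T : ptopologicalType) (p : S -> T)
    (pi : borel_probability S R) (mu : borel_probability T R) : Prop :=
  forall A : set (borel T), measurable A ->
    pushforward pi (p : borel S -> borel T) A = mu A.

Definition Pi_plans (R : realType) (X Y Z W : pmetricType R)
    (tauX : X -> Z -> Z) (tauY : Y -> W -> W)
    (mu : borel_probability X R) (nu : borel_probability Y R) :
    set (borel_probability (X * Y * Z * W)%type R) :=
  [set pi |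
    [/\ has_marginal (fun q : X * Y * Z * W => q.1.1.1) pi mu,
        has_marginal (fun q : X * Y * Z * W => q.1.1.2) pi nu,
        (forall g : Z -> R, continuous g ->
          (\int[pi]_q (g (tauX q.1.1.1 q.1.2))%:E = \int[pi]_q (g q.1.2)%:E)%E)
      & (forall f : W -> R, continuous f ->
          (\int[pi]_q (f (tauY q.1.1.2 q.2))%:E = \int[pi]_q (f q.2)%:E)%E)]].

Definition Phi_pairs (R : realType) (X Y Z W : pmetricType R)
    (tauX : X -> Z -> Z) (tauY : Y -> W -> W) (c : X * Y * Z * W -> R) :
    set ((X -> R) * (Y -> R)) :=
  [set p : (X -> R) * (Y -> R) | [/\ continuous p.1, continuous p.2 &
    exists (f : W -> R) (g : Z -> R), [/\ continuous f, continuous g &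
      forall (x : X) (y : Y) (z : Z) (w : W),
        c (x, y, z, w) + g (tauX x z) - g z + f (tauY y w) - f w
          <= p.1 x + p.2 y]]].

(* Main.v *)
Require Import Defs.
From HB Require Import structures.
From mathcomp Require Import all_boot all_order all_algebra.
From mathcomp Require Import all_classical all_reals all_analysis.
From mathcomp Require Import measurable_realfun lra.

(* For h continuous on S = X * Y * Z * W let p(h) be the infimum of
   int phi dmu + int psi dnu over the pairs (phi, psi) admissible for h.
   Evaluating the constraint at a minimum point of g and of f shows that
   p(h) >= min h, so p is a finite sublinear functional on C(S), and
   Hahn-Banach gives a linear L <= p with L c = p(c). The inequality L <= p
   makes L positive and normalized, and, applied to functions phi(x), psi(y),
   g(tau_x(z)) - g(z), f(tau_y(w)) - f(w) and their opposites, it says that the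
   probability representing L (Riesz) is a plan; its cost is L c = p(c). The
   contraction hypotheses enter only through the joint continuity of the
   maps. *)

Set Implicit Arguments.
Unset Strict Implicit.
Unset Printing Implicit Defensive.

Import Order.TTheory GRing.Theory Num.Theory.
Import numFieldTopology.Exports.
Import numFieldNormedType.Exports.

Local Open Scope classical_set_scope.
Local Open Scope ring_scope.

(** * Hahn-Banach theorem *)

(** The domain [D] is a predicate rather than a subtype: below, [V] is the module of all real
    functions on the product space and [D] singles out the continuous ones. *)
Definition sublinear_on (R : realType) (V : lmodType R) (D : set V)
    (p : V -> R) : Prop :=
  (forall u v, D u -> D v -> p (u + v) <= p u + p v) /\
  (forall (t : R) u, 0 <= t -> D u -> p (t *: u) = t * p u).

Definition linear_on (R : realType) (V : lmodType R) (D : set V)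
    (L : V -> R) : Prop :=
  (forall u v, D u -> D v -> L (u + v) = L u + L v) /\
  (forall (t : R) u, D u -> L (t *: u) = t * L u).

Section hahn_banach.
Variables (R : realType) (V : lmodType R) (D : set V).
Hypothesis DD : forall u v, D u -> D v -> D (u + v).
Hypothesis DZ : forall t u, D u -> D (t *: u).

Let DN u : D u -> D (- u).
Proof.
by move=> Du; rewrite -scaleN1r; exact: DZ.
Qed.

Lemma sublinear_on_opp (p : V -> R) (u : V) :
  sublinear_on D p -> D u -> - p (- u) <= p u.
Proof.
move=> [pD pZ] Du; have := pD _ _ Du (DN Du).
rewrite subrr -(scale0r u) pZ// mul0r; lra.
Qed.

(* q' x is the infimum of q (x + t y) - t q y over t >= 0. If q is minimal then
   q <= q', and the last bound gives q x + q y <= q (x + y). *)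
Lemma sublinear_on_tilt (q : V -> R) (y : V) : D y -> sublinear_on D q ->
  exists q' : V -> R, [/\ sublinear_on D q', forall x, D x -> q' x <= q x &
    forall x, D x -> q' x <= q (x + y) - q y].
Proof.
move=> Dy qsub; have [qD qZ] := qsub.
pose E x := [set q (x + t *: y) - t * q y | t in [set t | 0 <= t]].
have E0 x : E x !=set0 by exists (q (x + 0 *: y) - 0 * q y); exists 0 => /=.
(* Since q (t y) <= q (x + t y) + q (- x), the set [E x] is bounded below and [inf] is a true
   infimum. *)
have Elb x : D x -> lbound (E x) (- q (- x)).
  move=> Dx _ [t /= t0 <-].
  have := qD _ _ (DD Dx (DZ t Dy)) (DN Dx).
  rewrite [x + _]addrC addrK qZ//; lra.
have Einf x (t : R) : D x -> 0 <= t -> inf (E x) <= q (x + t *: y) - t * q y.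
  move=> Dx t0; apply: ge_inf; first by exists (- q (- x)); exact: Elb.
  by exists t.
exists (fun x => inf (E x)); split.
- split=> [u v Du Dv|t u t0 Du].
    rewrite -lerBlDl; apply: lb_le_inf => // _ [t /= t0 <-].
    rewrite lerBlDl -lerBlDr; apply: lb_le_inf => // _ [s /= s0 <-].
    (* Parameters s for u and t for v combine into the parameter s + t for u + v. *)
    rewrite lerBlDr; apply: le_trans (Einf _ (s + t) _ _) _.
    + exact: DD.
    + by rewrite addr_ge0.
    have := qD _ _ (DD Du (DZ s Dy)) (DD Dv (DZ t Dy)).
    rewrite addrACA -scalerDl; lra.
  move: t0; rewrite le_eqVlt => /predU1P[<-|t0].
    rewrite scale0r mul0r; apply/eqP; rewrite eq_le; apply/andP; split.
      have := Einf 0 0; rewrite scale0r addr0 mul0r subr0.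
      have -> : q 0 = 0 by rewrite -(scale0r u) qZ// mul0r.
      by apply => //; rewrite -(scale0r u); exact: DZ.
    apply: lb_le_inf => // _ [s /= s0 <-].
    by rewrite add0r qZ// subrr.
  apply/eqP; rewrite eq_le; apply/andP; split.
    rewrite -ler_pdivrMl//; apply: lb_le_inf => // _ [s /= s0 <-].
    rewrite ler_pdivrMl//; apply: le_trans (Einf _ (t * s) _ _) _.
    + exact: DZ.
    + by rewrite mulr_ge0// ltW.
    rewrite -scalerA -scalerDr qZ ?(ltW t0)//.
    + by rewrite mulrBr mulrA.
    + by apply: DD => //; exact: DZ.
  apply: lb_le_inf => // _ [s /= s0 <-].
  have := Einf u (t^-1 * s) Du;
  rewrite mulr_ge0 ?invr_ge0 ?(ltW t0)// => /(_ isT).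
  rewrite -(ler_pM2l t0) => /le_trans; apply.
  have Dus : D (u + (t^-1 * s) *: y) by apply: DD => //; exact: DZ.
  rewrite mulrBr -(qZ _ _ (ltW t0) Dus) scalerDr scalerA !mulrA.
  by rewrite divff ?gt_eqF// mul1r.
- move=> x Dx; have := Einf x 0 Dx (lexx _).
  by rewrite scale0r addr0 mul0r subr0.
- move=> x Dx; have := Einf x 1 Dx ler01.
  by rewrite scale1r mul1r.
Qed.

(** Zorn's lemma, with pointwise infima as bounds of chains. The infima are finite because every
    sublinear q <= p satisfies - p (- x) <= q x. *)
Lemma minimal_sublinear_on (p : V -> R) : sublinear_on D p ->
  exists q : V -> R, [/\ sublinear_on D q, forall x, D x -> q x <= p x &
    forall q', sublinear_on D q' -> (forall x, D x -> q' x <= q x) ->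
      forall x, D x -> q x <= q' x].
Proof.
move=> psub.
pose Q := {q : V -> R | sublinear_on D q /\ forall x, D x -> q x <= p x}.
pose q0 : Q := exist _ p (conj psub (fun x _ => lexx (p x))).
(* The order is reversed, so that a maximal element for [below] is a minimal functional. *)
pose below (s t : Q) := `[< forall x, D x -> sval t x <= sval s x >].
have Qlb (s : Q) x : D x -> - p (- x) <= sval s x.
  move=> Dx; have [ssub sp] := svalP s.
  apply: le_trans (sublinear_on_opp ssub Dx).
  by rewrite lerN2; apply: sp; exact: DN.
have [||A Atot|[q [qsub qp]] qmin] := @ZL_preorder Q q0 below.
- by move=> s; apply/asboolP.
- move=> s r t /asboolP sr /asboolP st; apply/asboolP => x Dx.
  exact: le_trans (st x Dx) (sr x Dx).
- have [->|/set0P[a Aa]] := eqVneq A set0.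
    by exists q0.
  pose E x := [set sval s x | s in A].
  have E0 x : E x !=set0 by exists (sval a x); exists a.
  have Einf x s : D x -> A s -> inf (E x) <= sval s x.
    move=> Dx As; apply: ge_inf; last by exists s.
    by exists (- p (- x)) => _ [r _ <-]; exact: Qlb.
  pose q x := inf (E x).
  have qsub : sublinear_on D q /\ forall x, D x -> q x <= p x.
    split; last first.
      by move=> x Dx; apply: le_trans (Einf x a Dx Aa) _; exact: (svalP a).2.
    split=> [u v Du Dv|t u t0 Du].
      rewrite -lerBlDl; apply: lb_le_inf => // _ [t At <-].
      rewrite lerBlDl -lerBlDr; apply: lb_le_inf => // _ [s As <-].
      rewrite lerBlDr.
      (* Subadditivity of the infimum needs one functional under both s and t; in a chain the
         smaller of the two serves. *)
      have [r [Ar rs rt]] : exists r : Q, [/\ A r, below s r & below t r].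
        have [st|ts] := Atot s t As At.
          by exists t; split => //; apply/asboolP.
        by exists s; split => //; apply/asboolP.
      move/asboolP : rs => rs; move/asboolP : rt => rt.
      apply: le_trans (Einf _ r (DD Du Dv) Ar) _.
      apply: le_trans ((svalP r).1.1 _ _ Du Dv) _.
      by apply: lerD; [exact: rs|exact: rt].
    have EZ : E (t *: u) = [set t * x | x in E u].
      apply/seteqP; split=> [_ [s As <-]|_ [_ [s As <-] <-]].
        exists (sval s u); first by exists s.
        by rewrite (svalP s).1.2.
      by exists s => //; rewrite (svalP s).1.2.
    move: t0; rewrite le_eqVlt => /predU1P[<-|t0].
      rewrite scale0r mul0r /q; have -> : E 0 = [set 0].
        apply/seteqP; split=> [_ [s As <-]|_ ->].
          by rewrite -(scale0r u) (svalP s).1.2// mul0r.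
        by exists a => //; rewrite -(scale0r u) (svalP a).1.2// mul0r.
      by rewrite inf1.
    apply/eqP; rewrite /q eq_le; apply/andP; split.
      rewrite -ler_pdivrMl//; apply: lb_le_inf => // _ [s As <-].
      rewrite ler_pdivrMl// -(svalP s).1.2 ?(ltW t0)//.
      by apply: Einf => //; exact: DZ.
    apply: lb_le_inf => // _ [s As <-].
    by rewrite (svalP s).1.2 ?(ltW t0)// ler_pM2l//; exact: Einf.
  by exists (exist _ q qsub) => s As; apply/asboolP => x Dx /=; exact: Einf.
- exists q; split => // q' q'sub q'q x Dx.
  have q'p y : D y -> q' y <= p y
    by move=> Dy; exact: le_trans (q'q y Dy) (qp y Dy).
  have := qmin (exist _ q' (conj q'sub q'p)).
  have {}q'q : below (exist _ q (conj qsub qp)) (exist _ q' (conj q'sub q'p)).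
    by apply/asboolP.
  by move=> /(_ q'q) /asboolP /(_ x Dx).
Qed.

(** A minimal sublinear functional is additive, because tilting it cannot lower it. Starting from
    the tilt of p along c, instead of p itself, forces the value at c. *)
Theorem hahn_banach (p : V -> R) (c : V) : sublinear_on D p -> D c ->
  exists L : V -> R, [/\ linear_on D L, forall x, D x -> L x <= p x &
    L c = p c].
Proof.
move=> psub Dc.
have [p' [p'sub p'p p'c]] := sublinear_on_tilt Dc psub.
have [L [Lsub Lp' Lmin]] := minimal_sublinear_on p'sub.
have D0 : D 0 by rewrite -(scale0r c); exact: DZ.
have L0 : L 0 = 0 by rewrite -(scale0r c) Lsub.2// mul0r.
have LD u v : D u -> D v -> L (u + v) = L u + L v.
  move=> Du Dv; apply/eqP; rewrite eq_le Lsub.1//=.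
  (* By minimality L lies under its own tilt along v, hence L u <= L (u + v) - L v. *)
  have [q [qsub qL qv]] := sublinear_on_tilt Dv Lsub.
  by rewrite -lerBrDr; exact: le_trans (Lmin _ qsub qL _ Du) (qv _ Du).
have LN u : D u -> L (- u) = - L u.
  move=> Du; apply/eqP; rewrite -addr_eq0 -LD ?subrr ?L0//; last exact: DN.
  by rewrite addrC subrr L0.
exists L; split.
- split=> // t u Du; have [t0|t0] := leP 0 t; first exact: Lsub.2.
  rewrite -[t]opprK scaleNr LN; last exact: DZ.
  by rewrite Lsub.2// ?mulNr// oppr_ge0 ltW.
- by move=> x Dx; exact: le_trans (Lp' x Dx) (p'p x Dx).
- apply/eqP; rewrite eq_le; apply/andP; split.
    exact: le_trans (Lp' c Dc) (p'p c Dc).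
  (* The tilt bound at - c reads L (- c) <= p 0 - p c. *)
  have := le_trans (Lp' _ (DN Dc)) (p'c _ (DN Dc)).
  have p0 : p 0 = 0 by rewrite -(scale0r c) psub.2// mul0r.
  by rewrite LN// addNr p0 sub0r lerN2.
Qed.

End hahn_banach.

(** * Borel integrals of continuous functions *)

(** This isolates what the uniqueness and representation arguments use of the metric. *)
Definition opens_are_cozero_sets (R : realType) (T : topologicalType) : Prop :=
  forall U : set T, open U -> exists d : T -> R,
    [/\ continuous d, forall x, 0 <= d x & U = [set x | 0 < d x]].

(** The function is the distance to the complement of U, truncated at 1 because that distance is
    infinite when the complement is empty. It is 1-Lipschitz, and it is positive on U because U
    contains a ball around each of its points. *)
Lemma pseudometric_opens_are_cozero_sets (R : realType)
  (T : pseudoMetricType R) : opens_are_cozero_sets R T.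
Proof.
move=> U oU; pose e := @edist_inf R T (~` U).
have e1fin x : Order.min 1%E (e x) \is a fin_num.
  rewrite ge0_fin_numE ?le_min ?lee01 ?edist_inf_ge0//.
  by rewrite gt_min ltry.
have flip x y r : 0 < r -> ball x r y ->
    fine (Order.min 1%E (e x)) <= r + fine (Order.min 1%E (e y)).
  move=> r0 xyr; rewrite -lee_fin EFinD !fineK//.
  have exy : (e x <= r%:E + e y)%E.
    apply: le_trans (edist_inf_triangle _ x y) _.
    by rewrite leeD2r// edist_fin.
  rewrite [X in (_ + X)%E]minEle; case: ifPn => _.
    by rewrite ge_min -[X in (X <= _)%E]add0e leeD2r// lee_fin ltW.
  by rewrite ge_min exy orbT.
exists (fun x => fine (Order.min 1%E (e x))); split.
- move=> x; apply/cvgrPdist_le => r r0.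
  have : nbhs x (ball x r) by exact: nbhsx_ballx.
  apply: filterS => y xyr.
  have := flip _ _ _ r0 xyr; have := flip _ _ _ r0 (ball_sym xyr).
  by rewrite ler_norml; lra.
- by move=> x; rewrite fine_ge0// le_min lee01 edist_inf_ge0.
- apply/seteqP; split=> x /=; last first.
    move=> x0; apply: contrapT => Ux.
    by move: x0; rewrite /e edist_inf0// minEle leNgt lte01 /= ltxx.
  move=> Ux; have : nbhs x U by exact: open_nbhs_nbhs.
  rewrite -nbhs_ballE => -[r /= r0 rU].
  rewrite -lte_fin fineK// lt_min lte01/=.
  apply: (@lt_le_trans _ _ r%:E); first by rewrite lte_fin.
  apply: le_ereal_inf_tmp => _ [a Ua <-].
  rewrite leNgt; apply/negP => xar; apply: Ua; apply: rU.
  exact: (edist_lt_ball xar).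
Qed.

Section ramp.
Variables (R : realType) (T : topologicalType).
Implicit Types (d : T -> R).

(** For d >= 0 these functions increase with n to the indicator of the set where d > 0. *)
Definition ramp d (n : nat) : T -> R := fun x => Num.min 1 (n%:R * d x).

Lemma continuous_ramp d n : continuous d -> continuous (ramp d n).
Proof.
move=> cd x; apply: (@continuous_min _ _ (cst 1) (fun x => n%:R * d x)).
  exact: cst_continuous.
by apply: (@continuousM _ _ (cst n%:R) d); [exact: cst_continuous|exact: cd].
Qed.

Lemma ramp_ge0 d n x : 0 <= d x -> 0 <= ramp d n x.
Proof.
by move=> d0; rewrite /ramp le_min ler01 mulr_ge0.
Qed.

Lemma ramp_le1 d n x : ramp d n x <= 1.
Proof. by rewrite /ramp ge_min lexx. Qed.

Lemma ramp_eq0 d n x : d x = 0 -> ramp d n x = 0.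
Proof.
by move=> d0; rewrite /ramp d0 mulr0 minEle leNgt ltr01.
Qed.

Lemma ramp_nondecreasing d m n x : 0 <= d x -> (m <= n)%N ->
  ramp d m x <= ramp d n x.
Proof.
move=> d0 mn; rewrite /ramp le_min ge_min lexx/= ge_min.
by rewrite ler_wpM2r ?ler_nat// orbT.
Qed.

Lemma ramp_eq1 d x : 0 < d x -> \forall n \near \oo, ramp d n x = 1.
Proof.
move=> d0; near=> n; apply/min_idPl.
rewrite -ler_pdivrMr// div1r; near: n; exact: nbhs_infty_ger.
Unshelve. all: by end_near. Qed.

End ramp.

Section borel_integral.
Variables (R : realType) (T : ptopologicalType).
Hypothesis compactT : compact [set: T].

Lemma continuous_measurable_borel (S : ptopologicalType) (p : T -> S) :
  continuous p -> measurable_fun setT (p : borel T -> borel S).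
Proof.
move=> /continuousP cp; apply: (@measurability _ _ (borel T) (borel S) setT p
  (@open S)) => //.
move=> _ [U oU <-]; rewrite setTI; apply: sub_sigma_algebra; exact: cp.
Qed.

Lemma continuous_measurable_borel_real (f : T -> R) :
  continuous f -> measurable_fun setT (f : borel T -> R).
Proof.
move=> /continuousP cf; apply: (measurability _ (RGenOpens.measurableE R)).
move=> _ [_ [a [b ->] <-]]; rewrite setTI; apply: sub_sigma_algebra.
exact/cf/interval_open.
Qed.

Lemma compact_continuous_bounded (f : T -> R) : continuous f ->
  exists M : R, forall x, `|f x| <= M.
Proof.
move=> cf; have ccf : {within setT, continuous (fun x => `|f x|)}.
  apply: continuous_subspaceT => x.
  by apply: continuous_comp; [exact: cf|exact: norm_continuous].
have [c _ fc] := compact_EVT_max (ex_intro setT point Logic.I) compactT ccf.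
by exists `|f c| => x; apply: fc; rewrite inE.
Qed.

Lemma continuous_integrable (P : borel_probability T R) (f : T -> R) :
  continuous f -> P.-integrable setT (EFin \o f).
Proof.
move=> cf; apply: measurable_bounded_integrable => //.
- exact: le_lt_trans (probability_le1 P measurableT) (ltry 1).
- exact: continuous_measurable_borel_real.
- have [M fM] := compact_continuous_bounded cf.
  exists M; split; first exact: num_real.
  by move=> e Me x _; exact: le_trans (fM x) (ltW Me).
Qed.

Lemma integral_continuousE (P : borel_probability T R) (f : T -> R) :
  continuous f -> (\int[P]_x (f x)%:E)%E = (\int[P]_x f x)%:E.
Proof.
by move=> cf; rewrite /Rintegral fineK//; apply: integrable_fin_num => //;
  exact: continuous_integrable.
Qed.

End borel_integral.

(** Ramps are continuous and converge boundedly to the indicator of an open set, so the two measures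
    agree on open sets. These are stable under intersection and generate the Borel sets. *)
Lemma measure_eq_of_integral (R : realType) (T : ptopologicalType)
    (m1 m2 : {measure set (borel T) -> \bar R}) :
  opens_are_cozero_sets R T ->
  m1 setT = 1%E -> m2 setT = 1%E ->
  (forall f : T -> R, continuous f ->
    (\int[m1]_x (f x)%:E = \int[m2]_x (f x)%:E)%E) ->
  forall A : set (borel T), measurable A -> m1 A = m2 A.
Proof.
move=> cozT m1T m2T m12.
have mU (m : {measure set (borel T) -> \bar R}) (d : T -> R) : m setT = 1%E ->
    continuous d -> (forall x, 0 <= d x) ->
    (\int[m]_x (ramp d n x)%:E)%E @[n --> \oo] --> m [set x | 0 < d x].
  move=> mT cd d0.
  have mdU : measurable ([set x | 0 < d x] : set (borel T)).
    apply: sub_sigma_algebra.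
    have -> : [set x | 0 < d x] = d @^-1` [set y | 0 < y] by [].
    by move/continuousP: cd; apply; exact: open_gt.
  have mramp n : measurable_fun setT (ramp d n : borel T -> R).
    apply: continuous_measurable_borel_real.
    exact: continuous_ramp.
  rewrite -(setIT [set x | 0 < d x]) -integral_indic//.
  have [] := @dominated_convergence _ _ _ m _ measurableT
    (fun n x => (ramp d n x)%:E) (fun x => (\1_([set x | 0 < d x]) x)%:E)
    (cst 1%E).
  - by move=> n; apply/measurable_EFinP.
  - by apply/measurable_EFinP; exact: measurable_indic.
  - apply: aeW => x _; apply: cvg_EFin; first by near=> n.
    rewrite /= indicE; have := d0 x; rewrite le_eqVlt => /predU1P[dx|dx].
      rewrite memNset/=; last by rewrite -dx ltxx.
      by under eq_fun do rewrite /= ramp_eq0//; exact: cvg_cst.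
    rewrite mem_set//=; apply: cvg_near_cst.
    exact: ramp_eq1.
  - apply/integrableP; split; first exact: measurable_cst.
    rewrite (eq_integral (cst 1%E)); last by move=> x _; rewrite /= normr1.
    by rewrite integral_cst// mT mul1e ltry.
  - apply: aeW => x n _; rewrite /= lee_fin ger0_norm ?ramp_le1//.
    exact: ramp_ge0.
  - by move=> _ _.
move=> A mA.
apply: (@measure_unique _ R (borel T) (@open T) (fun=> setT)) => //.
- by move=> B C; exact: openI.
- by move=> _; exact: openT.
- by rewrite bigcup_const//; exists 0%N.
- move=> U /cozT[d [cd d0 ->]].
  have m12d : (fun n => \int[m1]_x (ramp d n x)%:E)%E =
              (fun n => \int[m2]_x (ramp d n x)%:E)%E.
    by apply/funext => n; apply: m12; exact: continuous_ramp.
  have := mU m1 d m1T cd d0; rewrite m12d => m1U.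
  have := mU m2 d m2T cd d0 => m2U.
  exact: cvg_unique m1U m2U.
- by move=> _; rewrite m1T ltry.
Unshelve. all: by end_near. Qed.

(** * Riesz representation *)

Lemma continuous_cstM (R : realType) (T : topologicalType) (t : R)
    (f : T -> R) :
  continuous f -> continuous (fun x => t * f x).
Proof.
by move=> cf x; apply: (@continuousM _ _ (cst t) f);
  [exact: cst_continuous|exact: cf].
Qed.

Lemma continuous_big_sum (R : realType) (T : topologicalType) (n : nat)
    (f : nat -> T -> R) : (forall i, continuous (f i)) ->
  continuous (fun x => \sum_(i < n) f i x).
Proof.
move=> cf; elim: n => [|n IH] x.
  by under eq_fun do rewrite big_ord0; exact: cst_continuous.
under eq_fun do rewrite big_ord_recr/=.
by apply: (@continuousD _ _ _ _ (f n)); [exact: IH|exact: cf].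
Qed.

Lemma additive_sum (R : realType) (T : topologicalType) (J : (T -> R) -> R)
    (n : nat) (f : nat -> T -> R) :
  (forall g h : T -> R, continuous g -> continuous h ->
    J (fun x => g x + h x) = J g + J h) ->
  (forall i, continuous (f i)) ->
  J (fun x => \sum_(i < n) f i x) = \sum_(i < n) J (f i).
Proof.
move=> JD cf; elim: n => [|n IH].
  rewrite big_ord0; under eq_fun do rewrite big_ord0.
  have c0 : continuous (fun _ : T => 0 : R) by move=> x; exact: cst_continuous.
  have := JD _ _ c0 c0; under eq_fun do rewrite addr0.
  by move=> /eqP; rewrite -subr_eq0 opprD addNKr oppr_eq0 => /eqP.
rewrite big_ord_recr/= -IH -JD//; last exact: continuous_big_sum.
by congr J; apply/funext => x; rewrite big_ord_recr.
Qed.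

(** The i-th term is the length of the part of [0, y] lying in [i, i + 1]. *)
Lemma sum_unit_layers (R : realType) (y : R) (n : nat) : 0 <= y ->
  \sum_(i < n) Num.min 1 (Num.max 0 (y - i%:R)) = Num.min y n%:R.
Proof.
move=> y0; elim: n => [|n IH]; first by rewrite big_ord0 min_r.
rewrite big_ord_recr/= IH -natr1 !minEle !maxEle.
by do !case: ifPn; rewrite -?ltNge; lra.
Qed.

Section riesz.
Variables (R : realType) (T : ptopologicalType) (L : (T -> R) -> R).
Hypothesis compactT : compact [set: T].
Hypothesis cozT : opens_are_cozero_sets R T.
Hypothesis LD : forall f g : T -> R, continuous f -> continuous g ->
  L (fun x => f x + g x) = L f + L g.
Hypothesis LZ : forall (t : R) (f : T -> R), continuous f ->
  L (fun x => t * f x) = t * L f.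
Hypothesis L_ge0 : forall f : T -> R, continuous f ->
  (forall x, 0 <= f x) -> 0 <= L f.
Hypothesis L1 : L (fun=> 1) = 1.

Let Lcst (t : R) : L (fun=> t) = t.
Proof.
rewrite -[RHS]mulr1 -L1 -LZ; first by congr L; apply/funext => x; rewrite mulr1.
by move=> x; exact: cst_continuous.
Qed.

Let LB (f g : T -> R) : continuous f -> continuous g ->
  L (fun x => f x - g x) = L f - L g.
Proof.
move=> cf cg.
have cNg := continuous_cstM (t := -1) cg.
by rewrite -mulN1r -LZ// -LD//; congr L; apply/funext => x; rewrite mulN1r.
Qed.

Let le_L (f g : T -> R) : continuous f -> continuous g ->
  (forall x, f x <= g x) -> L f <= L g.
Proof.
move=> cf cg fg; rewrite -subr_ge0 -LB//; apply: L_ge0.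
  by move=> x; apply: continuousB; [exact: cg|exact: cf].
by move=> x; rewrite subr_ge0.
Qed.

(* Increasing sequences of functions replace the open covers of the usual
   construction: multiplying a sequence by the ramps of an open set, or by their
   complements to 1, splits a bound for X into bounds for X `&` U and X `&` ~`
     U,
   which is Caratheodory's condition. *)
Definition riesz_bound (A : set T) (l : R) : Prop :=
  exists u : nat -> T -> R, [/\ forall n, continuous (u n),
    forall n x, 0 <= u n x,
    forall m n x, (m <= n)%N -> u m x <= u n x,
    forall n, L (u n) <= l &
    forall x, A x -> exists n, 1 < u n x].

Definition riesz_outer (A : set T) : \bar R :=
  ereal_inf [set l%:E | l in riesz_bound A].

Let riesz_outer_le A l : riesz_bound A l -> (riesz_outer A <= l%:E)%E.
Proof.
by move=> Al; apply: ereal_inf_lbound; exists l.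
Qed.

Let riesz_outer_ge0 A : (0 <= riesz_outer A)%E.
Proof.
apply: le_ereal_inf_tmp => _ [l [u [cu u0 _ ul _]] <-].
by rewrite lee_fin (le_trans _ (ul 0%N))// L_ge0.
Qed.

(** [riesz_bound] asks for values strictly above 1, whereas h may equal 1 on A; multiplying h by a
    factor slightly above 1 repairs this at an arbitrarily small cost. *)
Lemma riesz_outer_le_functional A (h : T -> R) : continuous h ->
  (forall x, 0 <= h x) -> (forall x, A x -> 1 <= h x) ->
  (riesz_outer A <= (L h)%:E)%E.
Proof.
move=> ch h0 h1; apply/lee_addgt0Pr => e e0.
have Lh0 : 0 <= L h by exact: L_ge0.
(* The denominator 1 + L h is positive even when L h = 0, and it keeps t * L h within e of L h. *)
pose t := 1 + e / (1 + L h).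
have t1 : 1 < t by rewrite ltrDl divr_gt0// ltr_pwDl.
have tL : t * L h <= L h + e.
  rewrite mulrDl mul1r lerD2l -mulrA ler_piMr ?(ltW e0)//.
  by rewrite mulrC ler_pdivrMr ?ltr_pwDl// mul1r lerDr.
have t0 : 0 < t by exact: lt_trans t1.
rewrite -EFinD; apply: riesz_outer_le; exists (fun _ x => t * h x); split.
- by move=> _; exact: continuous_cstM.
- by move=> _ x; rewrite mulr_ge0// ltW.
- by [].
- by move=> _; rewrite LZ.
- move=> x Ax; exists 0%N; apply: lt_le_trans t1 _.
  by rewrite ler_peMr ?h1// ltW.
Qed.

Let riesz_outer_fin A : riesz_outer A \is a fin_num.
Proof.
rewrite ge0_fin_numE ?riesz_outer_ge0//;
  apply: le_lt_trans (ltry (L (fun=> 1))).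
by apply: riesz_outer_le_functional => // x; exact: cst_continuous.
Qed.

Let riesz_outer0 : riesz_outer set0 = 0%E.
Proof.
apply/eqP; rewrite eq_le riesz_outer_ge0 andbT.
have := @riesz_outer_le_functional set0 (fun=> 0); rewrite Lcst.
by apply => // x; exact: cst_continuous.
Qed.

Let riesz_outer_mono : {homo riesz_outer : A B / A `<=` B >-> (A <= B)%E}.
Proof.
move=> A B AB; apply: ereal_inf_le_tmp => _ [l [u [cu u0 uh ul uB]] <-].
by exists l => //; exists u; split => // x /AB /uB.
Qed.

(** Choose for each [F i] a sequence that is optimal up to e / 2 ^ (i + 1), and combine these
    sequences diagonally. *)
Let riesz_outer_sigma_subadditive : sigma_subadditive riesz_outer.
Proof.
move=> F; apply/lee_addgt0Pr => e e0.
apply: le_trans (epsilon_trick xpredT (fun i => riesz_outer_ge0 (F i))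
  (ltW e0)).
have /choice[lu lubnd] : forall i, exists lu : R * (nat -> T -> R),
    [/\ (lu.1%:E <= riesz_outer (F i) + (e / (2 ^ i.+1)%:R)%:E)%E,
    forall n, continuous (lu.2 n), forall n x, 0 <= lu.2 n x,
    forall m n x, (m <= n)%N -> lu.2 m x <= lu.2 n x &
    (forall n, L (lu.2 n) <= lu.1) /\
    forall x, F i x -> exists n, 1 < lu.2 n x].
  move=> i; have ei0 : 0 < e / (2 ^ i.+1)%:R :> R
    by rewrite divr_gt0// ltr0n expn_gt0.
  have [_ [l [u [cu u0 uh ul uF]] <-] /ltW lF] :=
    lb_ereal_inf_adherent ei0 (riesz_outer_fin (F i)).
  by exists (l, u).
pose l i := (lu i).1; pose u i := (lu i).2.
have cu i n : continuous (u i n) by have [_ + _ _ _] := lubnd i; exact.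
have u0 i n x : 0 <= u i n x by have [_ _ + _ _] := lubnd i; exact.
have uh i m n x : (m <= n)%N -> u i m x <= u i n x.
  by have [_ _ _ + _] := lubnd i; exact.
have ul i n : L (u i n) <= l i by have [_ _ _ _ [+ _]] := lubnd i; exact.
have l0 i : 0 <= l i.
  by rewrite (le_trans _ (ul i 0%N))// L_ge0.
apply: (@le_trans _ _ (\sum_(i <oo) (l i)%:E)%E); last first.
  apply: lee_nneseries => i _; first by rewrite lee_fin.
  by have [] := lubnd i.
have [->|s_fin] := eqVneq (\sum_(i <oo) (l i)%:E)%E +oo%E;
  first by rewrite leey.
have sE : (\sum_(i <oo) (l i)%:E)%E \is a fin_num.
  by rewrite ge0_fin_numE ?ltey// nneseries_ge0// => i _; rewrite lee_fin.
rewrite -(fineK sE); apply: riesz_outer_le.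
(* The n-th function sums only n terms, so it is continuous and L is additive on it; it still
   increases with n, as both the number of terms and each term grow. *)
exists (fun n x => \sum_(i < n) u i n x); split.
- by move=> n; apply: (continuous_big_sum (f := fun i => u i n)) => i;
  exact: cu.
- by move=> n x; apply: sumr_ge0 => i _; exact: u0.
- move=> m n x mn; rewrite -(subnKC mn) big_split_ord/= -[X in X <= _]addr0.
  apply: lerD; last by apply: sumr_ge0 => i _; exact: u0.
  by apply: ler_sum => i _; apply: uh; rewrite leq_addr.
- move=> n; rewrite (additive_sum n (f := fun i => u i n) LD); last first.
    by move=> i; exact: cu.
  apply: (@le_trans _ _ (\sum_(i < n) l i)).
    by apply: ler_sum => i _; exact: ul.
  rewrite -lee_fin fineK// -sumEFin -(big_mkord xpredT (fun i => (l i)%:E)).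
  by apply: nneseries_lim_ge => i _; rewrite lee_fin.
- move=> x [i _ Fix]; have [_ _ _ _ [_ /(_ _ Fix)[n un]]] := lubnd i.
  (* The index must reach n, for [u i] to exceed 1 at x, and i + 1, for the i-th sequence to be
     among the summands. *)
  exists (maxn n i.+1); apply: lt_le_trans un _.
  have im : (i < maxn n i.+1)%N by rewrite leq_max ltnSn orbT.
  rewrite (bigD1 (Ordinal im))//= -[X in X <= _]addr0; apply: lerD.
    by apply: uh; rewrite leq_maxl.
  by apply: sumr_ge0 => j _; exact: u0.
Qed.

HB.instance Definition _ := isOuterMeasure.Build R T riesz_outer
  riesz_outer0 riesz_outer_ge0 riesz_outer_mono riesz_outer_sigma_subadditive.

Lemma riesz_caratheodory_open (U : set T) : open U ->
  riesz_outer.-caratheodory U.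
Proof.
move=> /cozT[d [cd d0 UE]]; apply: le_caratheodory_measurable => X.
suff : (riesz_outer (X `&` U) + riesz_outer (X `&` ~` U) <= riesz_outer X)%E.
  by [].
apply: le_ereal_inf_tmp => _ [l [u [cu u0 uh ul uX]] <-].
have cr m : continuous (ramp d m) by exact: continuous_ramp.
have cv n m : continuous (fun x => u n x * ramp d m x).
  by move=> x; apply: (@continuousM _ _ (u n) (ramp d m));
    [exact: cu|exact: cr].
have cw n m : continuous (fun x => u n x * (1 - ramp d m x)).
  move=> x; apply: (@continuousM _ _ (u n) (fun x => 1 - ramp d m x)).
    exact: cu.
  by apply: (@continuousB _ _ _ (cst (1 : R)) (ramp d m));
    [exact: cst_continuous|exact: cr].
(* With m fixed, the functions [u n] times 1 - [ramp d m] bound X outside U, where the ramp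
   vanishes. What remains of l after paying for [u m] times the ramp bounds their values under L. *)
have out m : (riesz_outer (X `&` ~` U) <=
    (l - L (fun x => u m x * ramp d m x))%:E)%E.
  apply: riesz_outer_le; exists (fun n x => u n x * (1 - ramp d m x));
    split => //.
  - by move=> n x; rewrite mulr_ge0// subr_ge0 ramp_le1.
  - by move=> p n x pn; rewrite ler_wpM2r ?uh// subr_ge0 ramp_le1.
  - move=> n; rewrite lerBrDr -LD//; apply: le_trans (ul (maxn m n)).
    apply: le_L => // [|x].
      move=> x; apply: (@continuousD _ _ _ (fun x => u n x * (1 - ramp d m x))).
        exact: cw.
      exact: cv.
    (* At x the left side is a convex combination of [u n x] and [u m x], both at most the value at
       index [maxn m n]. *)
    have := uh n _ x (leq_maxr m n); have := uh m _ x (leq_maxl m n).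
    have := ramp_le1 d m x; have := ramp_ge0 m (d0 x).
    by nra.
  - move=> x [Xx Ux]; have [n un] := uX x Xx; exists n.
    rewrite ramp_eq0 ?subr0 ?mulr1//; apply/eqP; rewrite eq_le d0 andbT leNgt.
    by apply/negP => dx; apply: Ux; rewrite UE.
(* By [out], the diagonal sequence [u m] times [ramp d m] has values under L at most l minus the
   outer measure of X outside U; it bounds X inside U. *)
rewrite -leeBrDr ?riesz_outer_fin// -(fineK (riesz_outer_fin (X `&` ~` U)))
  -EFinB.
apply: riesz_outer_le; exists (fun m x => u m x * ramp d m x); split => //.
- by move=> n x; rewrite mulr_ge0// ramp_ge0.
- by move=> m n x mn; rewrite ler_pM ?ramp_ge0 ?uh ?ramp_nondecreasing.
- move=> n; have := out n; rewrite -(fineK (riesz_outer_fin (X `&` ~` U))).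
  by rewrite lee_fin; lra.
- rewrite UE => x [Xx dx]; have [n un] := uX x Xx.
  have [N _ rN] := ramp_eq1 dx; exists (maxn n N).
  rewrite rN ?mulr1 /= ?leq_maxr//.
  by apply: lt_le_trans un _; apply: uh; rewrite leq_maxl.
Qed.

Let riesz_caratheodory_borel (A : set (borel T)) : measurable A ->
  riesz_outer.-caratheodory A.
Proof.
apply: smallest_sub; last by move=> U; exact: riesz_caratheodory_open.
split.
- exact: caratheodory_measurable_set0.
- by move=> B mB; rewrite setTD; exact: caratheodory_measurable_setC.
- by move=> F mF; exact: caratheodory_measurable_bigcup.
Qed.

Definition riesz_measure (A : set (borel T)) : \bar R := riesz_outer A.

Let riesz_measure_semi_sigma_additive : semi_sigma_additive riesz_measure.
Proof.
move=> F mF tF mUF.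
apply: (@caratheodory_measure_sigma_additive R T riesz_outer) => //.
- by move=> i; exact: riesz_caratheodory_borel.
- exact: riesz_caratheodory_borel.
Qed.

HB.instance Definition _ := isMeasure.Build _ (borel T) R riesz_measure
  riesz_outer0 (fun A => riesz_outer_ge0 A) riesz_measure_semi_sigma_additive.

Let riesz_measure_setT : riesz_measure setT = 1%E.
Proof.
apply/eqP; rewrite eq_le; apply/andP; split.
  rewrite -L1; apply: riesz_outer_le_functional => // x; exact: cst_continuous.
apply: le_ereal_inf_tmp => _ [l [u [cu u0 uh ul uT]] <-].
(* By compactness and monotonicity in n, a single index N gives [u N] > 1 on the whole space, whence
   1 = L 1 <= L (u N) <= l. *)
have [] := (compact_near_coveringP setT).1 compactT nat \oo
  (fun n x => 1 < u n x) _ _.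
  move=> x _; have [n un] := uT x Logic.I.
  have nU : nbhs x (u n @^-1` [set y | 1 < y]).
    apply: cu; apply: open_nbhs_nbhs; split => //; exact: open_gt.
  exists (u n @^-1` [set y | 1 < y], [set m | (n <= m)%N]).
    by split => //; exists n.
  by move=> [y m] /= [uy nm]; apply: lt_le_trans uy (uh _ _ _ nm).
move=> N _ /(_ N (leqnn N)) uN.
rewrite lee_fin (le_trans _ (ul N))// -L1; apply: le_L => // x.
  exact: cst_continuous.
by apply/ltW/uN.
Qed.

HB.instance Definition _ :=
  Measure_isProbability.Build _ _ _ riesz_measure riesz_measure_setT.

Let P : borel_probability T R := riesz_measure.

Let P_integrable (f : T -> R) : continuous f -> P.-integrable setT (EFin \o f).
Proof. exact: continuous_integrable. Qed.

(** The indicator of the open set where h > 0 lies above h, and the measure of that set is at most L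
    k. *)
Let integral_le_functional_support (h k : T -> R) : continuous h ->
  continuous k -> (forall x, h x <= 1) -> (forall x, 0 <= k x) ->
  (forall x, 0 < h x -> 1 <= k x) -> \int[P]_x h x <= L k.
Proof.
move=> ch ck h1 k0 hk; pose U : set (borel T) := [set x | 0 < h x].
have mU : measurable U.
  apply: sub_sigma_algebra.
  have -> : U = h @^-1` [set y | 0 < y] by [].
  by move/continuousP: ch; apply; exact: open_gt.
apply: (@le_trans _ _ (\int[P]_x \1_U x)).
  apply: le_Rintegral => //; first exact: P_integrable.
    exact: integrable_indic.
  move=> x _; rewrite indicE; have [hx|hx] := ltP 0 (h x).
    by rewrite mem_set.
  by rewrite memNset//=; apply/negP; rewrite -leNgt.
rewrite /Rintegral integral_indic// setIT.
have := riesz_outer_le_functional ck k0 hk.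
by rewrite -[X in (X <= _)%E]fineK.
Qed.

Let Rintegral_continuousD (f g : T -> R) : continuous f -> continuous g ->
  \int[P]_x (f x + g x) = \int[P]_x f x + \int[P]_x g x.
Proof.
by move=> cf cg; apply: RintegralD => //; exact: P_integrable.
Qed.

Let Rintegral_continuousZ (t : R) (f : T -> R) : continuous f ->
  \int[P]_x (t * f x) = t * \int[P]_x f x.
Proof.
by move=> cf; apply: RintegralZl => //; exact: P_integrable.
Qed.

Let integral_le_functional01 (g : T -> R) : continuous g ->
  (forall x, 0 <= g x) -> (forall x, g x <= 1) -> \int[P]_x g x <= L g.
Proof.
move=> cg g0 g1; apply/ler_addgt0Pr => e e0.
(* The layers h i of height 1 of (n + 1) g satisfy h 0 <= 1, and h i = 1 wherever
   h i.+1 > 0. *)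
have [n _ /(_ n (leqnn n)) /= ne] := near_infty_natSinv_lt (PosNum e0).
pose h i x := Num.min 1 (Num.max 0 (n.+1%:R * g x - i%:R)).
have ch i : continuous (h i).
  move=> x; apply: (@continuous_min _ _ (cst (1 : R))
    (fun x => Num.max 0 (n.+1%:R * g x - i%:R))); first exact: cst_continuous.
  apply: (@continuous_max _ _ (cst (0 : R)) (fun x => n.+1%:R * g x - i%:R));
    first exact: cst_continuous.
  apply: (@continuousB _ _ _ (fun x => n.+1%:R * g x) (cst (i%:R : R))).
    exact: continuous_cstM.
  exact: cst_continuous.
have h_ge0 i x : 0 <= h i x by rewrite /h le_min ler01 le_max lexx.
have gh : (fun x => n.+1%:R * g x) = (fun x => \sum_(i < n.+1) h i x).
  apply/funext => x; rewrite sum_unit_layers ?mulr_ge0// min_l//.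
  by rewrite -[leRHS]mulr1 ler_wpM2l.
suff : n.+1%:R * \int[P]_x g x <= 1 + n.+1%:R * L g.
  rewrite -ler_pdivlMl// mulrDr mulr1 mulKf// => /le_trans; apply.
  by rewrite addrC lerD2l ltW.
have hP : \int[P]_x \sum_(i < n.+1) h i x = \sum_(i < n.+1) \int[P]_x h i x.
  exact: (@additive_sum _ _ (fun f => \int[P]_x f x) n.+1 h
    Rintegral_continuousD).
rewrite -Rintegral_continuousZ// -LZ// gh hP (additive_sum n.+1 LD)//.
(* Shift the layers by one: the integral of [h 0] is at most 1, that of [h i.+1] is at most L (h i),
   and the last term L (h n) is only dropped. Dividing by n + 1 leaves an error below e. *)
rewrite big_ord_recl [X in 1 + X]big_ord_recr/= lerD//.
  rewrite -[leRHS]L1; apply: integral_le_functional_support => //.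
    by move=> x; exact: cst_continuous.
  by move=> x; rewrite /h ge_min lexx.
rewrite -[leLHS]addr0 lerD//; last exact: L_ge0.
apply: ler_sum => i _; apply: integral_le_functional_support => //.
  by move=> x; rewrite /h ge_min lexx.
move=> x; rewrite /h lt_min ltr01/= lt_max ltxx/= => hx.
rewrite le_min lexx/= le_max; apply/orP; right.
move: hx; rewrite /bump/= -natr1; lra.
Qed.

Let integral_le_functional (f : T -> R) : continuous f -> \int[P]_x f x <= L f.
Proof.
move=> cf; have [M fM] := compact_continuous_bounded compactT cf.
pose K := 1 + `|M|; have K0 : 0 < K by rewrite ltr_pwDl.
have fK x : - K <= f x <= K.
  by rewrite -ler_norml (le_trans (fM x))// (le_trans (ler_norm M))// lerDr.
have cK : continuous (fun _ : T => K) by move=> x; exact: cst_continuous.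
have cfK : continuous (fun x => f x + K).
  by move=> x; apply: (@continuousD _ _ _ f (cst K)); [exact: cf|exact: cK].
(* Rescale f affinely to values in [0, 1]; the integral and L agree on constants, so the inequality
   transfers back to f. *)
have := @integral_le_functional01 (fun x => (2 * K)^-1 * (f x + K)).
rewrite Rintegral_continuousZ// LZ// Rintegral_continuousD// LD// Lcst.
have -> : \int[P]_x K = K.
  transitivity (K * fine (riesz_measure setT)); first exact: Rintegral_cst.
  by rewrite riesz_measure_setT mulr1.
rewrite ler_pM2l ?invr_gt0 ?mulr_gt0//.
rewrite lerD2r; apply; first exact: continuous_cstM.
- move=> x; rewrite mulr_ge0 ?invr_ge0 ?mulr_ge0 ?(ltW K0)//.
  by have /andP[] := fK x; lra.
- move=> x; rewrite mulrC ler_pdivrMr ?mulr_gt0//.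
  by have /andP[] := fK x; lra.
Qed.

(** The one-sided bound, applied to f and to - f, gives equality. *)
Theorem riesz_representation : exists P : borel_probability T R,
  forall f : T -> R, continuous f -> \int[P]_x f x = L f.
Proof.
exists P => f cf; apply/eqP; rewrite eq_le integral_le_functional//=.
have := integral_le_functional (continuous_cstM (t := -1) cf).
by rewrite Rintegral_continuousZ// LZ// !mulN1r lerN2.
Qed.

End riesz.

(** * Duality *)

Section marginals.
Variables (R : realType) (S T : ptopologicalType) (p : S -> T).
Variables (pi : borel_probability S R) (mu : borel_probability T R).
Hypothesis compactS : compact [set: S].
Hypothesis compactT : compact [set: T].
Hypothesis cp : continuous p.

Let mp : measurable_fun setT (p : borel S -> borel T).
Proof. exact: continuous_measurable_borel. Qed.

Let pushforward_integral (phi : T -> R) : continuous phi ->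
  (\int[pushforward pi (p : borel S -> borel T)]_x (phi x)%:E =
   \int[pi]_q (phi (p q))%:E)%E.
Proof.
move=> cphi.
have cphip : continuous (phi \o p).
  by move=> q; apply: continuous_comp; [exact: cp|exact: cphi].
apply: (@integral_pushforward _ _ _ _ _ _ mp pi setT
  (fun x => (phi x)%:E)) => //.
  by apply/measurable_EFinP; exact: continuous_measurable_borel_real.
exact: (continuous_integrable compactS pi cphip).
Qed.

Lemma has_marginal_integral (phi : T -> R) : has_marginal p pi mu ->
  continuous phi -> \int[pi]_q phi (p q) = \int[mu]_x phi x.
Proof.
move=> pimu cphi; rewrite /Rintegral; congr fine.
rewrite -pushforward_integral//; apply: eq_measure_integral => A mA _.
exact: pimu.
Qed.

Lemma integral_has_marginal : opens_are_cozero_sets R T ->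
  (forall phi : T -> R, continuous phi ->
    \int[pi]_q phi (p q) = \int[mu]_x phi x) ->
  has_marginal p pi mu.
Proof.
move=> cozT pimu A mA.
apply: (@measure_eq_of_integral R T (pushforward pi (p : borel S -> borel T))
  mu) => //.
- exact: (probability_setT pi).
- exact: (probability_setT mu).
- move=> phi cphi; rewrite pushforward_integral//.
  have cphip : continuous (phi \o p).
    by move=> q; apply: continuous_comp; [exact: cp|exact: cphi].
  rewrite (integral_continuousE compactT mu cphi) -pimu//.
  exact: (integral_continuousE compactS pi cphip).
Qed.

End marginals.

Lemma uniformly_contractive_continuous (R : realType) (X Z : pmetricType R)
    (tau : X -> Z -> Z) :
  uniformly_contractive tau -> continuous (fun q : X * Z => tau q.1 q.2).
Proof.
move=> [gamma [gamma0 gamma1 tauc]] [x z]; apply/cvg_ballP => e e0.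
(* As gamma < 1, two distances below e / 2 give an image distance below e. *)
have : nbhs (x, z) (ball (x, z) (e / 2)).
  by apply: nbhsx_ballx; rewrite divr_gt0.
apply: filterS => -[x' z'] [/=]; rewrite !ballEmdist /= => xx' zz'.
apply: le_lt_trans (tauc _ _ _ _) _.
have := mdist_ge0 x x'; have := mdist_ge0 z z'.
by nra.
Qed.

(** * The dual value as a sublinear functional, and optimal plans *)

Section duality.
Variables (R : realType) (X Y Z W : pmetricType R).
Hypothesis compactX : compact [set: X].
Hypothesis compactY : compact [set: Y].
Hypothesis compactZ : compact [set: Z].
Hypothesis compactW : compact [set: W].
Variables (tauX : X -> Z -> Z) (tauY : Y -> W -> W).
Hypothesis contrX : uniformly_contractive tauX.
Hypothesis contrY : uniformly_contractive tauY.
Variables (mu : borel_probability X R) (nu : borel_probability Y R).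

Local Notation S := (X * Y * Z * W)%type.

Let prX (q : S) := q.1.1.1.
Let prY (q : S) := q.1.1.2.
Let prZ (q : S) := q.1.2.
Let prW (q : S) := q.2.

Let compactS : compact [set: S].
Proof. by rewrite -!setXTT; do !apply: compact_setX. Qed.

Let c11 : continuous (fun q : S => q.1.1).
Proof.
by move=> q; apply: (@continuous_comp _ _ _ fst fst);
  [exact: cvg_fst|exact: cvg_fst].
Qed.

Let cprX : continuous prX.
Proof.
by move=> q; apply: (@continuous_comp _ _ _ (fun q : S => q.1.1) fst);
  [exact: c11|exact: cvg_fst].
Qed.

Let cprY : continuous prY.
Proof.
by move=> q; apply: (@continuous_comp _ _ _ (fun q : S => q.1.1) snd);
  [exact: c11|exact: cvg_snd].
Qed.

Let cprZ : continuous prZ.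
Proof.
by move=> q; apply: (@continuous_comp _ _ _ fst snd);
  [exact: cvg_fst|exact: cvg_snd].
Qed.

Let cprW : continuous prW.
Proof.
by move=> q; exact: cvg_snd.
Qed.

Let ctauX : continuous (fun q : S => tauX (prX q) (prZ q)).
Proof.
move=> q; apply: (@continuous_comp _ _ _
  (fun q : S => (prX q, prZ q)) (fun a => tauX a.1 a.2)).
  by apply: cvg_pair; [exact: cprX|exact: cprZ].
exact: uniformly_contractive_continuous.
Qed.

Let ctauY : continuous (fun q : S => tauY (prY q) (prW q)).
Proof.
move=> q; apply: (@continuous_comp _ _ _
  (fun q : S => (prY q, prW q)) (fun a => tauY a.1 a.2)).
  by apply: cvg_pair; [exact: cprY|exact: cprW].
exact: uniformly_contractive_continuous.
Qed.

Let ccomp (U : topologicalType) (a : S -> U) (b : U -> R) :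
  continuous a -> continuous b -> continuous (fun q => b (a q)).
Proof.
by move=> ca cb q; apply: continuous_comp; [exact: ca|exact: cb].
Qed.

Let cstC (U : topologicalType) (a : R) : continuous (fun _ : U => a).
Proof.
by move=> u; exact: cst_continuous.
Qed.

Let contD (U : topologicalType) (a b : U -> R) :
  continuous a -> continuous b -> continuous (fun u => a u + b u).
Proof.
by move=> ca cb u; apply: (@continuousD _ _ _ a b); [exact: ca|exact: cb].
Qed.

Let contB (U : topologicalType) (a b : U -> R) :
  continuous a -> continuous b -> continuous (fun u => a u - b u).
Proof.
by move=> ca cb u; apply: (@continuousB _ _ _ a b); [exact: ca|exact: cb].
Qed.

Let intD (U : ptopologicalType) (m : borel_probability U R) (a b : U -> R) :
  compact [set: U] -> continuous a -> continuous b ->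
  \int[m]_u (a u + b u) = \int[m]_u a u + \int[m]_u b u.
Proof.
by move=> cU ca cb; apply: RintegralD => //; exact: continuous_integrable.
Qed.

Let intB (U : ptopologicalType) (m : borel_probability U R) (a b : U -> R) :
  compact [set: U] -> continuous a -> continuous b ->
  \int[m]_u (a u - b u) = \int[m]_u a u - \int[m]_u b u.
Proof.
by move=> cU ca cb; apply: RintegralB => //; exact: continuous_integrable.
Qed.

Let intZ (U : ptopologicalType) (m : borel_probability U R) (t : R)
    (a : U -> R) :
  compact [set: U] -> continuous a ->
  \int[m]_u (t * a u) = t * \int[m]_u a u.
Proof.
by move=> cU ca; apply: RintegralZl => //; exact: continuous_integrable.
Qed.

Let intc (U : ptopologicalType) (m : borel_probability U R) (t : R) :
  \int[m]_u t = t.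
Proof.
transitivity (t * fine (m setT)); first exact: Rintegral_cst.
by rewrite (_ : m setT = 1%E) ?mulr1//; exact: probability_setT.
Qed.

Let le_int (U : ptopologicalType) (m : borel_probability U R) (a b : U -> R) :
  compact [set: U] -> continuous a -> continuous b -> (forall u, a u <= b u) ->
  \int[m]_u a u <= \int[m]_u b u.
Proof.
by move=> cU ca cb ab; apply: le_Rintegral => //; exact: continuous_integrable.
Qed.

Definition dual_values (h : S -> R) : set R :=
  [set \int[mu]_x p.1 x + \int[nu]_y p.2 y | p in Phi_pairs tauX tauY h].

Definition dual_value (h : S -> R) : R := inf (dual_values h).

Lemma dual_values_cst (h : S -> R) (M : R) : (forall q, h q <= M) ->
  dual_values h M.
Proof.
move=> hM; exists (fun=> M, fun=> 0) => /=; last by rewrite !intc addr0.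
split; [exact: cstC|exact: cstC|exists (fun=> 0), (fun=> 0)].
split; [exact: cstC|exact: cstC|move=> x y z w].
by rewrite addr0 subr0 addr0 subr0 addr0; exact: hM.
Qed.

(* At a minimum z of g and w of f the coboundary terms are nonnegative. *)
Lemma dual_values_lbound (h : S -> R) (m : R) : (forall q, m <= h q) ->
  lbound (dual_values h) m.
Proof.
move=> mh _ [[phi psi] /= [cphi cpsi [f [g [cf cg le_h]]]] <-].
have [z _ zmin] := compact_EVT_min (ex_intro setT point Logic.I) compactZ
  (continuous_subspaceT cg).
have [w _ wmin] := compact_EVT_min (ex_intro setT point Logic.I) compactW
  (continuous_subspaceT cf).
have mphipsi x y : m <= phi x + psi y.
  have := le_h x y z w; have := mh (x, y, z, w).
  have := zmin (tauX x z); rewrite inE => /(_ Logic.I).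
  have := wmin (tauY y w); rewrite inE => /(_ Logic.I) /=.
  by lra.
(* Integrate over y with x fixed, then over x; no product measure is needed. *)
have mphi x : m - phi x <= \int[nu]_y psi y.
  rewrite -[leLHS](intc nu); apply: le_int => // [|y]; first exact: cstC.
  by rewrite lerBlDl.
rewrite -lerBlDr -[leLHS](intc mu); apply: le_int => // [|x]; first exact: cstC.
have := mphi x; lra.
Qed.

Let cbounded (h : S -> R) : continuous h ->
  exists M, forall q, - M <= h q <= M.
Proof.
move=> ch; have [M hM] := compact_continuous_bounded compactS ch.
by exists M => q; rewrite -ler_norml.
Qed.

Lemma dual_values_nonempty (h : S -> R) : continuous h -> dual_values h !=set0.
Proof.
move=> /cbounded[M hM]; exists M; apply: dual_values_cst => q.
by have /andP[] := hM q.
Qed.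

Lemma dual_values_has_lbound (h : S -> R) : continuous h ->
  has_lbound (dual_values h).
Proof.
move=> /cbounded[M hM]; exists (- M); apply: dual_values_lbound => q.
by have /andP[] := hM q.
Qed.

Let dual_value_le (h : S -> R) (v : R) : continuous h -> dual_values h v ->
  dual_value h <= v.
Proof.
by move=> ch hv; apply: ge_inf => //; exact: dual_values_has_lbound.
Qed.

Let dual_valuesD (h k : S -> R) (v w : R) : dual_values h v ->
  dual_values k w -> dual_values (fun q => h q + k q) (v + w).
Proof.
move=> [[phi psi] /= [cphi cpsi [f [g [cf cg le_h]]]] <-].
move=> [[phi' psi'] /= [cphi' cpsi' [f' [g' [cf' cg' le_k]]]] <-].
exists (fun x => phi x + phi' x, fun y => psi y + psi' y) => /=.
  split; [exact: contD|exact: contD|].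
  exists (fun w => f w + f' w), (fun z => g z + g' z).
  split; [exact: contD|exact: contD|move=> x y z w0].
  by have := le_h x y z w0; have := le_k x y z w0 => /=; lra.
by rewrite !intD//; lra.
Qed.

Let dual_valuesZ (h : S -> R) (t v : R) : 0 < t -> dual_values h v ->
  dual_values (fun q => t * h q) (t * v).
Proof.
move=> t0 [[phi psi] /= [cphi cpsi [f [g [cf cg le_h]]]] <-].
exists (fun x => t * phi x, fun y => t * psi y) => /=.
  split; [exact: continuous_cstM|exact: continuous_cstM|].
  exists (fun w => t * f w), (fun z => t * g z).
  split; [exact: continuous_cstM|exact: continuous_cstM|move=> x y z w].
  by have := le_h x y z w; rewrite /= -(ler_pM2l t0); lra.
by rewrite !intZ//; lra.
Qed.

Lemma dual_value_sublinear :
  @sublinear_on R (S -> R^o) [set h : S -> R | continuous h] dual_value.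
Proof.
split=> [u v /= cu cv|t u t0 /= cu].
  rewrite -lerBlDl; apply: lb_le_inf => [|b vb];
    first exact: dual_values_nonempty.
  rewrite lerBlDl -lerBlDr; apply: lb_le_inf => [|a ua].
    exact: dual_values_nonempty.
  rewrite lerBlDr; apply: dual_value_le; first exact: contD.
  exact: dual_valuesD.
(* One inequality suffices: the converse is the same bound for the factor t^-1 and the function t *
   u. *)
have dZ (s : R) (h : S -> R) : 0 < s -> continuous h ->
    dual_value (fun q => s * h q) <= s * dual_value h.
  move=> s0 ch; rewrite -ler_pdivrMl//; apply: lb_le_inf => [|a ha].
    exact: dual_values_nonempty.
  rewrite ler_pdivrMl//; apply: dual_value_le; first exact: continuous_cstM.
  exact: dual_valuesZ.
have E s : s *: (u : S -> R^o) = (fun q => s * u q) :> (S -> R) by [].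
rewrite E; move: t0; rewrite le_eqVlt => /predU1P[<-|t0].
  rewrite mul0r; have -> : (fun q => 0 * u q) = (fun=> 0).
    by apply/funext => q; rewrite mul0r.
  apply/eqP; rewrite eq_le; apply/andP; split.
    by apply: dual_value_le; [exact: cstC|exact: dual_values_cst].
  apply: lb_le_inf; first by apply: dual_values_nonempty; exact: cstC.
  exact: dual_values_lbound.
apply/eqP; rewrite eq_le dZ//=.
have := @dZ t^-1 (fun q => t * u q); rewrite invr_gt0 => /(_ t0).
have -> : (fun q => t^-1 * (t * u q)) = u.
  by apply/funext => q; rewrite mulKf// gt_eqF.
by rewrite ler_pdivlMl//; apply; exact: continuous_cstM.
Qed.

(** Weak duality: integrate the constraint against the plan. The coboundary terms of f and g have
    integral zero by the invariance conditions, and the marginals turn the right side into v. *)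
Lemma plan_integral_le (pi : borel_probability S R) (h : S -> R) (v : R) :
  continuous h -> Pi_plans tauX tauY mu nu pi -> dual_values h v ->
  \int[pi]_q h q <= v.
Proof.
move=> ch [piX piY piZ piW] [[phi psi] /= [cphi cpsi [f [g [cf cg le_h]]]] <-].
rewrite -(has_marginal_integral compactS cprX piX cphi).
rewrite -(has_marginal_integral compactS cprY piY cpsi).
have cgt : continuous (fun q : S => g (tauX (prX q) (prZ q))) by exact: ccomp.
have cgz : continuous (fun q : S => g (prZ q)) by exact: ccomp.
have cft : continuous (fun q : S => f (tauY (prY q) (prW q))) by exact: ccomp.
have cfw : continuous (fun q : S => f (prW q)) by exact: ccomp.
have iZ : \int[pi]_q g (tauX (prX q) (prZ q)) = \int[pi]_q g (prZ q).
  by rewrite /Rintegral; congr fine; exact: piZ.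
have iW : \int[pi]_q f (tauY (prY q) (prW q)) = \int[pi]_q f (prW q).
  by rewrite /Rintegral; congr fine; exact: piW.
have cphi' : continuous (fun q : S => phi (prX q)) by exact: ccomp.
have cpsi' : continuous (fun q : S => psi (prY q)) by exact: ccomp.
rewrite -intD//.
have -> : \int[pi]_q h q = \int[pi]_q
    (h q + g (tauX (prX q) (prZ q)) - g (prZ q)
    + f (tauY (prY q) (prW q)) - f (prW q)).
  have c1 := contD ch cgt; have c2 := contB c1 cgz; have c3 := contD c2 cft.
  by rewrite intB// intD// intB// intD// iZ iW; lra.
have c1 := contD ch cgt; have c2 := contB c1 cgz; have c3 := contD c2 cft.
apply: le_int => //; first exact: contB.
  exact: contD.
by move=> [[[x y] z] w]; exact: le_h.
Qed.

Lemma exists_optimal_plan (c : S -> R) : continuous c ->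
  exists pi : borel_probability S R, Pi_plans tauX tauY mu nu pi /\
    \int[pi]_q c q = dual_value c.
Proof.
move=> cc.
have [L [[LD LZ] Ldual Lc]] := @hahn_banach R (S -> R^o)
  [set h : S -> R | continuous h] (fun u v => @contD S u v)
  (fun t u => @continuous_cstM R S t u) dual_value c dual_value_sublinear cc.
have Lle (h : S -> R) v : continuous h -> dual_values h v -> L h <= v.
  move=> ch hv; apply: le_trans (Ldual _ ch) _; exact: dual_value_le.
have Lcst_le (h : S -> R) M : continuous h -> (forall q, h q <= M) -> L h <= M.
  by move=> ch hM; apply: Lle => //; exact: dual_values_cst.
have LN (h : S -> R) : continuous h -> L (fun q => - h q) = - L h.
  move=> ch; rewrite -mulN1r -LZ//; congr L.
  by apply/funext => q; rewrite [RHS]mulN1r.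
have contN (h : S -> R) : continuous h -> continuous (fun q => - h q).
  by move=> ch q; apply: continuousN; exact: ch.
have L_ge0 (h : S -> R) : continuous h -> (forall q, 0 <= h q) -> 0 <= L h.
  move=> ch h0; rewrite -oppr_le0 -LN//; apply: Lcst_le; first exact: contN.
  by move=> q; rewrite oppr_le0.
have L1 : L (fun=> 1) = 1.
  apply/eqP; rewrite eq_le Lcst_le//=; last exact: cstC.
  rewrite -lerN2 -LN; last exact: cstC.
  by apply: Lcst_le => //; exact: cstC.
have [pi piL] := riesz_representation compactS
  (@pseudometric_opens_are_cozero_sets R S) LD LZ L_ge0 L1.
exists pi; split; last by rewrite piL.
(* An equality for L comes from admissible pairs of value 0 for both h and - h. *)
have L_eq0 (h : S -> R) : continuous h -> dual_values h 0 ->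
    dual_values (fun q => - h q) 0 -> L h = 0.
  move=> ch h0 Nh0; apply/eqP; rewrite eq_le Lle//= -oppr_le0 -LN//.
  by apply: Lle => //; exact: contN.
split.
- apply: (integral_has_marginal compactS compactX cprX).
    exact: pseudometric_opens_are_cozero_sets.
  have le1 (phi : X -> R) : continuous phi -> L (fun q => phi (prX q)) <=
    \int[mu]_x phi x.
    move=> cphi; apply: Lle; first exact: ccomp.
    exists (phi, fun=> 0) => /=; last by rewrite intc addr0.
    split=> //; first exact: cstC.
    exists (fun=> 0), (fun=> 0); split; [exact: cstC|exact: cstC|].
    by move=> x y z w; rewrite /prX/=; lra.
  (* The bound [le1] for phi and for - phi gives equality of the integrals. *)
  move=> phi cphi; rewrite (piL (fun q => phi (prX q))); last exact: ccomp.
  apply/eqP; rewrite eq_le le1//=.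
  have := le1 _ (continuous_cstM (t := -1) cphi); rewrite intZ// mulN1r.
  rewrite (LZ (-1) (fun q => phi (prX q))) ?mulN1r ?lerN2//; exact: ccomp.
- apply: (integral_has_marginal compactS compactY cprY).
    exact: pseudometric_opens_are_cozero_sets.
  have le1 (psi : Y -> R) : continuous psi -> L (fun q => psi (prY q)) <=
    \int[nu]_y psi y.
    move=> cpsi; apply: Lle; first exact: ccomp.
    exists (fun=> 0, psi) => /=; last by rewrite intc add0r.
    split=> //; first exact: cstC.
    exists (fun=> 0), (fun=> 0); split; [exact: cstC|exact: cstC|].
    by move=> x y z w; rewrite /prY/=; lra.
  move=> psi cpsi; rewrite (piL (fun q => psi (prY q))); last exact: ccomp.
  apply/eqP; rewrite eq_le le1//=.
  have := le1 _ (continuous_cstM (t := -1) cpsi); rewrite intZ// mulN1r.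
  rewrite (LZ (-1) (fun q => psi (prY q))) ?mulN1r ?lerN2//; exact: ccomp.
- move=> g cg.
  have cgt : continuous (fun q : S => g (tauX (prX q) (prZ q))) by exact: ccomp.
  have cgz : continuous (fun q : S => g (prZ q)) by exact: ccomp.
  rewrite (integral_continuousE compactS pi cgt)
    (integral_continuousE compactS pi cgz).
  congr EFin; apply/eqP; rewrite -subr_eq0 -intB// piL; last exact: contB.
  (* The coboundary of g is cancelled in the constraint by taking - g there, and its opposite by
     taking g, both with phi = psi = 0. *)
  apply/eqP; apply: L_eq0; first exact: contB.
    exists (fun=> 0, fun=> 0) => /=; last by rewrite !intc addr0.
    split; [exact: cstC|exact: cstC|].
    exists (fun=> 0), (fun z => - g z); split; [exact: cstC| |].
      by move=> z; apply: continuousN; exact: cg.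
    by move=> x y z w; rewrite /prX /prZ/=; lra.
  exists (fun=> 0, fun=> 0) => /=; last by rewrite !intc addr0.
  split; [exact: cstC|exact: cstC|].
  exists (fun=> 0), g; split; [exact: cstC|by []|].
  by move=> x y z w; rewrite /prX /prZ/=; lra.
- move=> f cf.
  have cft : continuous (fun q : S => f (tauY (prY q) (prW q))) by exact: ccomp.
  have cfw : continuous (fun q : S => f (prW q)) by exact: ccomp.
  rewrite (integral_continuousE compactS pi cft)
    (integral_continuousE compactS pi cfw).
  congr EFin; apply/eqP; rewrite -subr_eq0 -intB// piL; last exact: contB.
  apply/eqP; apply: L_eq0; first exact: contB.
    exists (fun=> 0, fun=> 0) => /=; last by rewrite !intc addr0.
    split; [exact: cstC|exact: cstC|].
    exists (fun w => - f w), (fun=> 0); split; [ |exact: cstC|].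
      by move=> w; apply: continuousN; exact: cf.
    by move=> x y z w; rewrite /prY /prW/=; lra.
  exists (fun=> 0, fun=> 0) => /=; last by rewrite !intc addr0.
  split; [exact: cstC|exact: cstC|].
  exists f, (fun=> 0); split; [by []|exact: cstC|].
  by move=> x y z w; rewrite /prY /prW/=; lra.
Qed.

End duality.

Theorem theorem21 (R : realType) (X Y Z W : pmetricType R)
    (compactX : compact [set: X]) (compactY : compact [set: Y])
    (compactZ : compact [set: Z]) (compactW : compact [set: W])
    (tauX : X -> Z -> Z) (tauY : Y -> W -> W)
    (contrX : uniformly_contractive tauX)
    (contrY : uniformly_contractive tauY)
    (mu : borel_probability X R) (nu : borel_probability Y R)
    (c : X * Y * Z * W -> R) (continuous_c : continuous c) :
  ereal_inf [set (\int[mu]_x (p.1 x)%:E + \int[nu]_y (p.2 y)%:E)%E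
            | p in Phi_pairs tauX tauY c] =
  ereal_sup [set (\int[pi]_q (c q)%:E)%E
            | pi in Pi_plans tauX tauY mu nu].
Proof.
have compactS : compact [set: X * Y * Z * W].
  by rewrite -!setXTT; do !apply: compact_setX.
(* All these integrals are finite, so the extended infimum reduces to the real number
   [dual_value]. *)
have -> : [set (\int[mu]_x (p.1 x)%:E + \int[nu]_y (p.2 y)%:E)%E
    | p in Phi_pairs tauX tauY c] = EFin @` dual_values tauX tauY mu nu c.
  rewrite image_comp; apply: eq_imagel => -[phi psi] /= [cphi cpsi _].
  rewrite EFinD -(integral_continuousE compactX)//.
  by rewrite -(integral_continuousE compactY).
have [pi [Pi_pi pic]] := exists_optimal_plan compactX compactY compactZ
  compactW contrX contrY mu nu continuous_c.
rewrite ereal_inf_EFin;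
  [|exact: dual_values_has_lbound|exact: dual_values_nonempty].
(* The optimal plan attains the dual value; weak duality bounds every other plan. *)
apply/eqP; rewrite eq_le; apply/andP; split.
  apply: ereal_sup_ubound; exists pi => //.
  by rewrite (integral_continuousE compactS)// pic.
apply: ge_ereal_sup => _ [rho Pi_rho <-].
rewrite (integral_continuousE compactS)// lee_fin.
apply: lb_le_inf; first exact: dual_values_nonempty.
by move=> v cv; exact: plan_integral_le cv.
Qed.
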